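(* Let $n\ge 2$ and $m\ge 1$ be fixed integers, let $\mathcal{A}$ be a set of admissible preference profiles with $n$ alternatives and $m$ individuals, and let $\varphi:\mathcal{A}\to\mathbb{R}^n$ be a scoring procedure. Then $\varphi$ is self-consistent if and only if $\varphi$ has a monotone implicit form.
   Context: **Profiles.** The integers $n$ (number of alternatives) and $m$ (number of individuals) are fixed. Let $X=\{1,\dots,n\}$ be the set of alternatives, $M=\{1,\dots,m\}$, and $X_i=X\setminus\{i\}$ for $i\in X$. A preference profile is a tuple $\mathbf{A}=(A^{(1)},\dots,A^{(m)})$ where each $A^{(p)}=(a_{ij}^p)$ is an $n\times n$ real matrix with $a_{ij}^p\in[0,1]$ and $a_{ij}^p+a_{ji}^p=1$ for $i\ne j$, and $a_{ii}^p=0$. Arbitrary further restrictions may be imposed on the profiles; $\mathcal{A}$ denotes the set of all admissible profiles, i.e. $\mathcal{A}$ is an arbitrary set of such profiles. **Scoring procedure.** A scoring procedure (scoring operator) is a function $\varphi:\mathcal{A}\to\mathbb{R}^n$. Write $\varphi(\mathbf{A})=(s_1,\dots,s_n)$; $s_i$ is the score of alternative $i$ in $\mathbf{A}$. For another profile $\mathbf{A}'\in\mathcal{A}$ with entries $a'^{\,p}_{ij}$, write $\varphi(\mathbf{A}')=(s'_1,\dots,s'_n)$. **Performance multiset.** The performance multiset of $i$ in $\mathbf{A}$ is the multiset $U_i=\{(a_{ik}^p,s_k)\mid k\in X_i,\ p\in M\}$ (multiplicities counted, so it has $m(n-1)$ elements). $U'_j$ denotes the performance multiset of $j$ in $\mathbf{A}'$.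 **Majorization.** Let $\mathbf{A},\mathbf{A}'\in\mathcal{A}$ (possibly equal) and $i,j\in X$ (possibly equal). Alternative $i$ in $\mathbf{A}$ majorizes $j$ in $\mathbf{A}'$ if there is a one-to-one mapping $\mu$ from $U_i$ onto $U'_j$ (a bijection between elements counted with multiplicity, i.e. between the index sets $X_i\times M$ and $X_j\times M$) such that $\mu\big((a_{ik}^p,s_k)\big)=(a'^{\,q}_{j\ell},s'_\ell)$ implies $a_{ik}^p\ge a'^{\,q}_{j\ell}$ and $s_k\ge s'_\ell$. It strictly majorizes if, in addition, at least one of these inequalities is strict for at least one comparison outcome $a_{ik}^p$. **Self-consistency.** $\varphi$ is self-consistent if for all $\mathbf{A},\mathbf{A}'\in\mathcal{A}$ and all $i,j\in X$: (1) if $i$ in $\mathbf{A}$ majorizes $j$ in $\mathbf{A}'$, then $s_i\ge s'_j$; (2) if $i$ in $\mathbf{A}$ strictly majorizes $j$ in $\mathbf{A}'$, then $s_i>s'_j$. **Monotone implicit form.** Let $\mathcal{T}$ be the set of all multisets consisting of $m(n-1)$ triples of real numbers. $\varphi$ has a monotone implicit form if there exists a function $g:\mathcal{T}\to\mathbb{R}$ such that: (i) for every profile $\mathbf{A}\in\mathcal{A}$, the scores $(s_1,\dots,s_n)=\varphi(\mathbf{A})$ satisfy $$g\big(\{(a_{ij}^p,s_j,s_i)\mid j\in X_i,\ p\in M\}\big)=0,\qquad i=1,\dots,n,$$ where the argument of $g$ is a multiset; (ii) $g$ is strictly increasing in every $a_{ij}^p$ and every $s_j$ and strictly decreasing in $s_i$;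 that is, on $\mathcal{T}$, $g$ is strictly increasing in the first component of each triple, strictly increasing in the second component of each triple, and strictly decreasing in the third component of each triple (the remaining components being held fixed). *)

(* Defs.v *)
From mathcomp Require Import all_boot all_order all_algebra.
From mathcomp Require Import finmap multiset.
From mathcomp Require Import boolp classical_sets reals.

Set Implicit Arguments.
Unset Strict Implicit.
Unset Printing Implicit Defensive.

Import Order.TTheory GRing.Theory Num.Theory.
Local Open Scope classical_set_scope.
Local Open Scope mset_scope.
Local Open Scope ring_scope.

(* [A p i j] is the entry a_ij^p.  The alternatives 1, ..., n are represented
   by 'I_n and the individuals 1, ..., m by 'I_m. *)
Notation matrices R n m := {ffun 'I_m -> 'M[R]_n}.

Definition is_profile (R : realType) (n m : nat) (A : matrices R n m) : Prop :=
  [/\ forall p i j, 0 <= A p i j <= 1,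
      forall p i j, i != j -> A p i j + A p j i = 1
    & forall p i, A p i i = 0].

(* X_i *)
Notation others i := {k | k != i}.

(* The performance multiset U_i, presented as a family indexed by X_i x M, so
   that its elements are counted with multiplicity. *)
Definition performance (R : realType) (n m : nat) (A : matrices R n m)
    (s : 'rV[R]_n) (i : 'I_n) (x : others i * 'I_m) : R * R :=
  (A x.2 i (val x.1), s 0 (val x.1)).

Section Majorization.
Variables (R : realType) (n m : nat).
Variables (A A' : matrices R n m) (s s' : 'rV[R]_n) (i j : 'I_n).

Definition majorizing (mu : others i * 'I_m -> others j * 'I_m) : Prop :=
  bijective mu /\
  forall x, (performance A' s' (mu x)).1 <= (performance A s x).1 /\
            (performance A' s' (mu x)).2 <= (performance A s x).2.

Definition majorizes : Prop := exists mu, majorizing mu.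

Definition strictly_majorizes : Prop :=
  exists mu, majorizing mu /\
  exists x, (performance A' s' (mu x)).1 < (performance A s x).1 \/
            (performance A' s' (mu x)).2 < (performance A s x).2.

End Majorization.

Definition self_consistent (R : realType) (n m : nat)
    (AA : set (matrices R n m)) (phi : AA -> 'rV[R]_n) : Prop :=
  forall (A A' : AA) (i j : 'I_n),
    (majorizes (val A) (val A') (phi A) (phi A') i j ->
       phi A' 0 j <= phi A 0 i) /\
    (strictly_majorizes (val A) (val A') (phi A) (phi A') i j ->
       phi A' 0 j < phi A 0 i).

(* The set T of all multisets of m (n - 1) triples of reals. *)
Definition triples (R : realType) (n m : nat) : Type :=
  {t : {mset R * R * R} | size t == (m * n.-1)%N}.

Definition implicit_mset (R : realType) (n m : nat) (A : matrices R n m)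
    (s : 'rV[R]_n) (i : 'I_n) : {mset R * R * R} :=
  seq_mset [seq (performance A s x, s 0 i) | x : others i * 'I_m].

Lemma size_implicit_mset (R : realType) (n m : nat) (A : matrices R n m)
    (s : 'rV[R]_n) (i : 'I_n) : size (implicit_mset A s i) == (m * n.-1)%N.
Proof.
rewrite (perm_size (perm_eq_seq_mset _)) size_map -cardT card_prod card_ord.
by rewrite card_sig (cardC1 i) card_ord mulnC.
Qed.

Definition implicit_arg (R : realType) (n m : nat) (A : matrices R n m)
    (s : 'rV[R]_n) (i : 'I_n) : triples R n m :=
  Sub (implicit_mset A s i) (size_implicit_mset A s i).

(* In the monotonicity clauses, [u] collects the remaining m (n - 1) - 1
   triples, which are held fixed. *)
Definition has_monotone_implicit_form (R : realType) (n m : nat)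
    (AA : set (matrices R n m)) (phi : AA -> 'rV[R]_n) : Prop :=
  exists g : triples R n m -> R,
  [/\ forall (A : AA) (i : 'I_n), g (implicit_arg (val A) (phi A) i) = 0,
      forall (t t' : triples R n m) (u : {mset R * R * R}) (a a' b c : R),
        val t = (a, b, c) +` u -> val t' = (a', b, c) +` u ->
        a < a' -> g t < g t',
      forall (t t' : triples R n m) (u : {mset R * R * R}) (a b b' c : R),
        val t = (a, b, c) +` u -> val t' = (a, b', c) +` u ->
        b < b' -> g t < g t'
    & forall (t t' : triples R n m) (u : {mset R * R * R}) (a b c c' : R),
        val t = (a, b, c) +` u -> val t' = (a, b, c') +` u ->
        c < c' -> g t' < g t].

(* Main.v *)
(** Self-consistency says exactly that the realized multisets, those of the form
    {(a_ij^p, s_j, s_i)}, form an antichain for the order on multisets of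
    triples induced by the components (the third one reversed).  Any strictly
    increasing [w], here the sum of all a + b - c, can then be modified so as
    to vanish on them: take [exp w] above some realized multiset, [0] on the
    realized ones and [- exp (- w)] elsewhere.  Conversely, a strictly
    increasing function cannot vanish at two comparable multisets. *)

Require Import Defs.
From mathcomp Require Import all_boot all_order all_algebra.
From mathcomp Require Import boolp classical_sets reals.
From mathcomp Require Import perm finmap multiset.
From mathcomp Require Import sequences exp lra.

Set Implicit Arguments.
Unset Strict Implicit.
Unset Printing Implicit Defensive.

Import Order.TTheory GRing.Theory Num.Theory.
Local Open Scope classical_set_scope.
Local Open Scope mset_scope.
Local Open Scope ring_scope.

(** * Multisets enumerated by finite families *)

Section Families.
Variable K : choiceType.
Implicit Types (I J : finType) (u : {mset K}) (e : K).

Definition family_mset {I} (f : I -> K) : {mset K} :=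
  seq_mset [seq f x | x : I].

Lemma size_family_mset I (f : I -> K) : size (family_mset f) = #|I|.
Proof. by rewrite (perm_size (perm_eq_seq_mset _)) size_map -cardT. Qed.

Lemma in_family_mset I (f : I -> K) e :
  (e \in family_mset f) = (e \in codom f).
Proof. by rewrite (perm_mem (perm_eq_seq_mset _)). Qed.

Lemma family_msetD1 I (f : I -> K) (x : I) :
  family_mset f = (f x +` seq_mset [seq f y | y <- rem x (enum I)])%mset.
Proof.
rewrite -mset_cons; apply/eq_seq_msetP.
by apply: (perm_map f (perm_to_rem _)); rewrite mem_enum.
Qed.

Lemma family_mset_update I (f : I -> K) (x : I) e :
  family_mset [eta f with x |-> e] =
  (e +` seq_mset [seq f y | y <- rem x (enum I)])%mset.
Proof.
rewrite (family_msetD1 _ x) /= eqxx; congr (_ `+` seq_mset _)%mset.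
apply/eq_in_map => y /=.
by rewrite (mem_rem_uniq _ (enum_uniq I)) inE => /andP[/negbTE ->].
Qed.

(** Membership provides an index carrying [e], and cancelling [e] identifies [u] with the values at
    the other indices. *)
Lemma family_mset_replace I (f : I -> K) e e' u :
  family_mset f = (e +` u)%mset ->
  exists2 x, f x = e & family_mset [eta f with x |-> e'] = (e' +` u)%mset.
Proof.
move=> fE; have : e \in family_mset f by rewrite fE in_msetD in_mset1 eqxx.
rewrite in_family_mset => /codomP[x eE]; exists x => //.
rewrite family_mset_update; congr (_ `+` _)%mset.
by move: fE; rewrite (family_msetD1 f x) -eE => /(can_inj (msetDKB _)).
Qed.

Lemma family_mset_reindex I J (mu : I -> J) (f : J -> K) :
  bijective mu -> family_mset (f \o mu) = family_mset f.
Proof.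
move=> mu_bij; apply/eq_seq_msetP; rewrite !/image_mem (map_comp f mu).
apply: perm_map; apply: uniq_perm;
  rewrite ?(map_inj_uniq (bij_inj mu_bij)) ?enum_uniq //.
move=> y; rewrite mem_enum; case: mu_bij => nu _ nuK.
by rewrite -[y]nuK; apply: map_f; rewrite mem_enum.
Qed.

(** The two enumerations are permutations of each other; the permutation of positions, transported
    through [enum_rank] and [enum_val], is the bijection. *)
Lemma family_mset_bij I J (f : I -> K) (g : J -> K) :
  family_mset f = family_mset g ->
  exists mu : I -> J, bijective mu /\ forall x, g (mu x) = f x.
Proof.
move=> fg; have eqIJ : #|I| = #|J|.
  by rewrite -(size_family_mset f) fg size_family_mset.
move/eq_seq_msetP: fg => /(@tuple_permP _ _ _ (codom_tuple g))[p pE].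
exists (fun x => enum_val (p (cast_ord eqIJ (enum_rank x)))); split.
  apply: (bij_comp (enum_val_bij J)).
  apply: (bij_comp (injF_bij (@perm_inj _ p))).
  apply: (bij_comp _ (enum_rank_bij I)).
  by exists (cast_ord (esym eqIJ)); [apply: cast_ordK | apply: cast_ordKV].
move=> x; rewrite -{2}(enum_rankK x) -(nth_codom (f x) f) [codom f]pE.
set i := cast_ord _ _; rewrite -[nat_of_ord (enum_rank x)]/(nat_of_ord i).
by rewrite -tnth_nth tnth_mktuple (tnth_nth (f x)) /= nth_codom.
Qed.

End Families.

(** * The order on triples and strictly increasing functions of multisets *)

Section Triples.
Variable R : realType.
Implicit Types (e : R * R * R) (t u : {mset R * R * R}).

Definition triple_le e e' : bool :=
  [&& e.1.1 <= e'.1.1, e.1.2 <= e'.1.2 & e'.2 <= e.2].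

Lemma triple_le_trans e2 e1 e3 :
  triple_le e1 e2 -> triple_le e2 e3 -> triple_le e1 e3.
Proof.
move=> /and3P[a12 b12 c12] /and3P[a23 b23 c23].
apply/and3P; split.
- exact: le_trans a23.
- exact: le_trans b23.
- exact: le_trans c12.
Qed.

Lemma triple_le_anti e e' : triple_le e e' -> triple_le e' e -> e = e'.
Proof.
case: e e' => [[a b] c] [[a' b'] c'] /and3P[/= h1 h2 h3] /and3P[/= k1 k2 k3].
by congr (_, _, _); apply: le_anti; rewrite ?h1 ?h2 ?h3 ?k1 ?k2 ?k3.
Qed.

Definition triple_lt e e' : bool := (e != e') && triple_le e e'.

Lemma triple_le_lt_trans e2 e1 e3 :
  triple_le e1 e2 -> triple_lt e2 e3 -> triple_lt e1 e3.
Proof.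
move=> le12 /andP[ne23 le23].
rewrite /triple_lt (triple_le_trans le12) // andbT.
by apply: contraNneq ne23 => e13; apply/eqP/triple_le_anti; rewrite // -?e13.
Qed.

Definition weight e : R := e.1.1 + e.1.2 - e.2.

Lemma weight_lt e e' : triple_lt e e' -> weight e < weight e'.
Proof.
case: e e' => [[a b] c] [[a' b'] c'] /andP[/eqP ne /and3P[/= ha hb hc]].
rewrite /weight /= ltNge; apply/negP => le_w; apply: ne.
by congr (_, _, _); lra.
Qed.

Definition mset_weight t : R := \sum_(e <- t) weight e.

Lemma mset_weightD1 e u : mset_weight (e +` u) = weight e + mset_weight u.
Proof.
rewrite /mset_weight -[in LHS](seq_mset_id u) -mset_cons.
by rewrite (perm_big _ (perm_eq_seq_mset _)) big_cons.
Qed.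

Definition family_lt (I : finType) (f f' : I -> R * R * R) : Prop :=
  (forall x, triple_le (f x) (f' x)) /\ exists x, triple_lt (f x) (f' x).

Section Increasing.
Variables (n m : nat) (g : triples R n m -> R).

Definition increasing : Prop :=
  forall (t t' : triples R n m) u e e', val t = e +` u -> val t' = e' +` u ->
    triple_lt e e' -> g t < g t'.

(** Raising a triple splits into moves of its three components, one at a time; [leif] records that a
    move gives equality only if it changes nothing. *)
Lemma increasing_components :
  increasing <->
  [/\ forall (t t' : triples R n m) u (a a' b c : R),
        val t = (a, b, c) +` u -> val t' = (a', b, c) +` u ->
        a < a' -> g t < g t',
      forall (t t' : triples R n m) u (a b b' c : R),
        val t = (a, b, c) +` u -> val t' = (a, b', c) +` u ->
        b < b' -> g t < g t'
    & forall (t t' : triples R n m) u (a b c c' : R),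
        val t = (a, b, c) +` u -> val t' = (a, b, c') +` u ->
        c < c' -> g t' < g t].
Proof.
split=> [g_incr|[g1 g2 g3]].
  have strict a a' b b' c c' :
      (a < a') || (b < b') || (c' < c) -> a <= a' -> b <= b' -> c' <= c ->
      triple_lt (a, b, c) (a', b', c').
    move=> lt ha hb hc; rewrite /triple_lt /triple_le ha hb hc !andbT.
    by apply: contraTN lt => /eqP[-> -> ->]; rewrite !ltxx.
  split=> [t t' u a a' b c|t t' u a b b' c|t t' u a b c c'] tE t'E lt.
  - apply: (g_incr _ _ _ _ _ tE t'E).
    by apply: strict; rewrite ?lt // ltW.
  - apply: (g_incr _ _ _ _ _ tE t'E).
    by apply: strict; rewrite ?lt ?orbT // ltW.
  - apply: (g_incr _ _ _ _ _ t'E tE).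
    by apply: strict; rewrite ?lt ?orbT // ltW.
move=> t t' u [[a b] c] [[a' b'] c'] tE t'E /andP[ne /and3P[/= ha hb hc]].
(* The intermediate multisets must be elements of [triples] for [g] to apply. *)
have size_u e : size (e +` u : {mset R * R * R}) == (m * n.-1)%N.
  rewrite -(eqP (valP t)) tE -(seq_mset_id u) -!mset_cons.
  by rewrite !(perm_size (perm_eq_seq_mset _)).
pose T e : triples R n m := Sub (e +` u) (size_u e).
have -> : t = T (a, b, c) by apply: val_inj.
have -> : t' = T (a', b', c') by apply: val_inj.
have le1 : g (T (a, b, c)) <= g (T (a', b, c)) ?= iff (a == a').
  apply/leifP; case: eqVneq ha => [->//|neq ha].
  by apply: g1; rewrite // lt_neqAle neq.
have le2 : g (T (a', b, c)) <= g (T (a', b', c)) ?= iff (b == b').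
  apply/leifP; case: eqVneq hb => [->//|neq hb].
  by apply: g2; rewrite // lt_neqAle neq.
have le3 : g (T (a', b', c)) <= g (T (a', b', c')) ?= iff (c' == c).
  apply/leifP; case: eqVneq hc => [->//|neq hc].
  by apply: g3; rewrite // lt_neqAle neq.
have [le eq] := leif_trans (leif_trans le1 le2) le3.
rewrite lt_neqAle le eq andbT; apply: contraNN ne.
by case/andP=> /andP[/eqP -> /eqP ->] /eqP ->.
Qed.

(* The values of [f] are replaced by those of [f'] one index at a time. *)
Lemma increasing_family (I : finType) (f f' : I -> R * R * R)
    (t t' : triples R n m) :
  increasing -> val t = family_mset f -> val t' = family_mset f' ->
  family_lt f f' -> g t < g t'.
Proof.
move=> g_incr tE t'E [le_ff' [x0 lt_x0]].
(* Induction on the number of indices where the families differ. *)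
have [k] := ubnP #|[pred x | f x != f' x]|.
elim: k => // k IHk in f t x0 tE le_ff' lt_x0 *; rewrite ltnS => le_k.
pose f1 := [eta f with x0 |-> f' x0].
have size_f1 : size (family_mset f1) == (m * n.-1)%N.
  by rewrite size_family_mset -(eqP (valP t)) tE size_family_mset.
pose t1 : triples R n m := Sub (family_mset f1) size_f1.
have lt_t1 : g t < g t1.
  apply: (g_incr _ _ _ _ _ _ _ lt_x0); first by rewrite tE (family_msetD1 f x0).
  by rewrite /= family_mset_update.
have le_f1 x : triple_le (f1 x) (f' x).
  by rewrite /f1 /=; case: eqP => [->|//]; rewrite /triple_le !lexx.
(* Either [f'] is reached, or some index still differs, and strictly so because [f1] lies below
   [f']. *)
have [f1E|/existsNP[x1 ne_x1]] := pselect (forall x, f1 x = f' x).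
  suff -> : t' = t1 by [].
  by apply: val_inj; rewrite t'E /=; congr family_mset; apply/funext => x.
apply: (lt_trans lt_t1); apply: (IHk f1 _ x1) => //.
  by rewrite /triple_lt le_f1 andbT; apply/eqP.
apply: leq_trans le_k; apply/proper_card/properP; split.
  apply/fintype.subsetP => x; rewrite !inE /f1 /=; case: ifP => // /eqP ->.
  by rewrite eqxx.
by exists x0; rewrite !inE /f1 /= ?eqxx //; case/andP: lt_x0.
Qed.

End Increasing.

(** The value [e] of [f'] at some index is raised to [e']; by transitivity the comparison with [f]
    is strict there. *)
Lemma family_lt_replace (I : finType) (f f' : I -> R * R * R) e e' u :
  (forall x, triple_le (f x) (f' x)) -> family_mset f' = e +` u ->
  triple_lt e e' ->
  exists2 f'', family_mset f'' = e' +` u & family_lt f f''.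
Proof.
move=> le_ff' f'E lt_ee'; have [x f'x f''E] := family_mset_replace e' f'E.
have lt_x : triple_lt (f x) e'.
  by apply: triple_le_lt_trans lt_ee'; rewrite -f'x.
exists [eta f' with x |-> e'] => //; split; last by exists x; rewrite /= eqxx.
by move=> y /=; case: eqP => [->|//]; case/andP: lt_x.
Qed.

End Triples.

(** * Self-consistency and comparison of realized multisets *)

Section Main.
Variables (R : realType) (n m : nat) (AA : set (matrices R n m)).
Variable phi : AA -> 'rV[R]_n.

(** Kept as a family, so that the bijections of majorization act by reindexing. *)
Definition scored (A : AA) (i : 'I_n) (x : others i * 'I_m) : R * R * R :=
  (performance (val A) (phi A) x, phi A 0 i).

Lemma implicit_argE (A : AA) (i : 'I_n) :
  val (implicit_arg (val A) (phi A) i) = family_mset (@scored A i).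
Proof. by []. Qed.

Lemma monotone_implicit_formP :
  has_monotone_implicit_form phi <->
  exists2 g : triples R n m -> R,
    forall (A : AA) (i : 'I_n), g (implicit_arg (val A) (phi A) i) = 0 &
    increasing g.
Proof.
split=> [[g [g0 g1 g2 g3]]|[g g0 g_incr]]; exists g => //.
  exact/increasing_components.
by have [g1 g2 g3] := (increasing_components g).1 g_incr; split.
Qed.

Lemma others_inhabited (i : 'I_n) : (1 < n)%N -> (0 < m)%N ->
  exists x : others i * 'I_m, True.
Proof.
move=> n_gt1 m_gt0; have : (0 < #|predC1 i|)%N.
  by rewrite cardC1 card_ord -subn1 subn_gt0.
by case/card_gt0P=> k ki; exists (exist _ k ki, Ordinal m_gt0).
Qed.

Lemma self_consistent_of_implicit_form : (1 < n)%N -> (0 < m)%N ->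
  has_monotone_implicit_form phi -> self_consistent phi.
Proof.
move=> n_gt1 m_gt0 /monotone_implicit_formP[g g0 g_incr].
(* A strict comparison would give [0 < 0], since [g] vanishes at both multisets. *)
have key (A A' : AA) (i j : 'I_n) (mu : others i * 'I_m -> others j * 'I_m) :
    bijective mu -> ~ family_lt (@scored A' j \o mu) (@scored A i).
  move=> mu_bij lt_ji; suff : (0 : R) < 0 by rewrite ltxx.
  rewrite -{1}(g0 A' j) -(g0 A i).
  apply: (increasing_family g_incr _ (implicit_argE _ _) lt_ji).
  by rewrite implicit_argE family_mset_reindex.
move=> A A' i j; split=> [[mu [mu_bij le_mu]]|[mu [[mu_bij le_mu] [x lt_x]]]].
  (* If [i] scored less than [j], the reversed third component would make every comparison strict;
     one index then suffices. *)
  rewrite leNgt; apply/negP => lt_ij; apply: (key A A' i j mu mu_bij).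
  have lt_x x : triple_lt (scored A' (mu x)) (scored A x).
    have [le1 le2] := le_mu x.
    rewrite /triple_lt /triple_le le1 le2 (ltW lt_ij) !andbT.
    by apply/eqP => -[_ _ eq_ij]; rewrite eq_ij ltxx in lt_ij.
  split; first by move=> x; case/andP: (lt_x x).
  by have [x _] := others_inhabited i n_gt1 m_gt0; exists x; apply: lt_x.
(* Here the third components compare only weakly, and strictness comes from [lt_x]. *)
rewrite ltNge; apply/negP => le_ij; apply: (key A A' i j mu mu_bij).
have le_x y : triple_le (scored A' (mu y)) (scored A y).
  by have [le1 le2] := le_mu y; rewrite /triple_le le1 le2 le_ij.
split=> //; exists x; rewrite /triple_lt le_x andbT; apply/eqP => -[eq1 eq2 _].
by case: lt_x; rewrite /performance /= ?eq1 ?eq2 ltxx.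
Qed.

(** The inverse of [mu] shows that [j] majorizes [i], while the third components order the scores
    the other way. The scores are thus equal, so the strict triple makes the majorization strict, a
    contradiction. *)
Lemma scored_antichain (A A' : AA) (i j : 'I_n)
    (mu : others i * 'I_m -> others j * 'I_m) :
  self_consistent phi -> bijective mu ->
  ~ family_lt (@scored A i) (@scored A' j \o mu).
Proof.
move=> sc mu_bij [le_mu [x0 lt_x0]]; have [nu muK nuK] := mu_bij.
have nu_maj : majorizing (val A') (val A) (phi A') (phi A) nu.
  split; first by exists mu.
  by move=> y; have /and3P[] := le_mu (nu y); rewrite /= nuK.
have le_ij := (sc A' A j i).1 (ex_intro _ nu nu_maj).
have /andP[ne /and3P[/= le1 le2 le_ji]] := lt_x0.
have eq_ij : phi A 0 i = phi A' 0 j by apply: le_anti; rewrite le_ij.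
suff : phi A 0 i < phi A' 0 j by rewrite eq_ij ltxx.
apply: (sc A' A j i).2; exists nu; split=> //; exists (mu x0); rewrite muK.
apply: contrapT => /not_orP[/negP]; rewrite -leNgt => ge1.
move=> /negP; rewrite -leNgt => ge2.
case/eqP: ne; rewrite /scored /= eq_ij; congr (_, _).
rewrite [LHS]surjective_pairing [RHS]surjective_pairing.
by congr (_, _); apply: le_anti; rewrite ?ge1 ?ge2 ?le1 ?le2.
Qed.

(** * Construction of the implicit function *)

Definition realized (t : {mset R * R * R}) : Prop :=
  exists (A : AA) (i : 'I_n), t = family_mset (@scored A i).

Definition above_realized (t : {mset R * R * R}) : Prop :=
  exists (A : AA) (i : 'I_n) f, t = family_mset f /\ family_lt (@scored A i) f.

Lemma realized_not_above t : self_consistent phi ->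
  realized t -> ~ above_realized t.
Proof.
move=> sc [A' [j ->]] [A [i [f [tE lt_f]]]].
have [mu [mu_bij muE]] := family_mset_bij (esym tE).
apply: (scored_antichain sc mu_bij (A := A)).
by rewrite (_ : _ \o mu = f) //; apply/funext => x; apply: muE.
Qed.

(** A realized multiset lies weakly above itself, so both cases reduce to [family_lt_replace]. *)
Lemma above_realized_step u e e' : triple_lt e e' ->
  realized (e +` u) \/ above_realized (e +` u) -> above_realized (e' +` u).
Proof.
move=> lt_ee' [[A [i tE]]|[A [i [f [tE [le_f _]]]]]]; exists A, i.
  have le_refl x : triple_le (@scored A i x) (scored A x).
    by rewrite /triple_le !lexx.
  by have [f fE lt_f] := family_lt_replace le_refl (esym tE) lt_ee'; exists f.
by have [f' fE lt_f] := family_lt_replace le_f (esym tE) lt_ee'; exists f'.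
Qed.

(** The exponentials fix the sign of each region and preserve the order given by the weight. *)
Definition implicit_form (t : {mset R * R * R}) : R :=
  if `[< above_realized t >] then expR (mset_weight t)
  else if `[< realized t >] then 0
  else - expR (- mset_weight t).

(** Raising a triple never leaves the positive region and moves a zero into it; within the positive
    or the negative region the weight decides. *)
Lemma implicit_form_lt u e e' : self_consistent phi -> triple_lt e e' ->
  implicit_form (e +` u) < implicit_form (e' +` u).
Proof.
move=> sc lt_ee'; have lt_w : mset_weight (e +` u) < mset_weight (e' +` u).
  by rewrite !mset_weightD1 ltrD2r weight_lt.
rewrite /implicit_form; case: asboolP => [up|not_up].
  rewrite asboolT ?ltr_expR //; apply: (above_realized_step lt_ee'); by right.
case: asboolP => [z|not_z].
  rewrite asboolT ?expR_gt0 //; apply: (above_realized_step lt_ee'); by left.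
(* The lower value is negative; the upper one may be positive, zero or negative. *)
case: asboolP => _; last case: asboolP => _.
- by rewrite (lt_trans (y := 0)) ?oppr_lt0 ?expR_gt0.
- by rewrite oppr_lt0 expR_gt0.
- by rewrite ltrN2 ltr_expR ltrN2.
Qed.

Lemma implicit_form_of_self_consistent :
  self_consistent phi -> has_monotone_implicit_form phi.
Proof.
move=> sc; apply/monotone_implicit_formP; exists (implicit_form \o val).
  move=> A i; have z : realized (family_mset (@scored A i)) by exists A, i.
  rewrite /= /implicit_form asboolF; first by rewrite asboolT.
  exact: realized_not_above.
by move=> t t' u e e' tE t'E lt_ee'; rewrite /= tE t'E implicit_form_lt.
Qed.

End Main.

Theorem mainTheorem1 (R : realType) (n m : nat) (hn : (2 <= n)%N)
    (hm : (1 <= m)%N) (AA : set (matrices R n m))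
    (hAA : forall A, AA A -> is_profile A) (phi : AA -> 'rV[R]_n) :
  self_consistent phi <-> has_monotone_implicit_form phi.
Proof.
split; first exact: implicit_form_of_self_consistent.
exact: self_consistent_of_implicit_form.
Qed.
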